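(* Let $D=(X,\mathcal{B})$ be a finite affine plane of order $q$, i.e. a $2$-$(q^2,q,1)$ design. Then $\gamma(D)=2q-1$.
   Context: A $2$-$(v,k,\lambda)$ design $D=(X,\mathcal{B})$ consists of a set $X$ of $v$ points and a family $\mathcal{B}$ of $k$-subsets (blocks) such that every pair of distinct points lies in exactly $\lambda$ blocks (with $v\geq k\geq 2$). The incidence graph $G_D$ has vertex set $X\cup\mathcal{B}$ with $x$ adjacent to $B$ iff $x\in B$. A dominating set is a set $S$ of vertices such that every vertex not in $S$ is adjacent to some vertex of $S$; $\gamma(D)$ is the minimum size of a dominating set of $G_D$. *)

(* Defs.v *)
From mathcomp Require Import all_boot.

Set Implicit Arguments.
Unset Strict Implicit.
Unset Printing Implicit Defensive.

(* The family of blocks is indexed by a finite type I, so a k-subset may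
   a priori occur several times; a set of blocks is the case where B is
   injective. *)
Definition is_2_design (X I : finType) (B : I -> {set X})
    (v k lambda : nat) : Prop :=
  [/\ 2 <= k <= v,
      #|X| = v,
      forall i : I, #|B i| = k &
      forall x y : X, x != y ->
        #|[set i : I | (x \in B i) && (y \in B i)]| = lambda].

Definition is_affine_plane (X I : finType) (B : I -> {set X}) (q : nat) : Prop :=
  is_2_design B (q ^ 2) q 1.

Definition incidence_graph (X I : finType) (B : I -> {set X}) : rel (X + I) :=
  fun u w => match u, w with
             | inl x, inr i => x \in B i
             | inr i, inl x => x \in B i
             | _, _ => false
             end.

Definition dominating (V : finType) (e : rel V) (S : {set V}) : bool :=
  [forall u, (u \notin S) ==> [exists w in S, e u w]].

Lemma dominating_setT (V : finType) (e : rel V) : dominating e [set: V].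
Proof. by apply/forallP => u; rewrite inE. Qed.

(* The minimum is attained because the full vertex set is dominating, by
   dominating_setT. *)
Definition domination_number (V : finType) (e : rel V) : nat :=
  #|[arg min_(S < [set: V] | dominating e S) #|S|]|.

Definition design_gamma (X I : finType) (B : I -> {set X}) : nat :=
  domination_number (incidence_graph B).

(* Main.v *)
(** Upper bound: the points of a line [l] together with the [q - 1] lines
    disjoint from [l] dominate.  Lower bound: let a dominating set have [p]
    points and [m] lines.  The lines cover the other points, so
    [q^2 - p <= m q].  Each of the [p] points is on [q + 1] lines, one of which
    passes through a fixed point among them, so [q^2 + q - m <= 1 + p q].
    Adding up, [(2q - 1)(q + 1) <= (p + m)(q + 1)]. *)
Require Import Defs.
From mathcomp Require Import all_boot.
From mathcomp Require Import zify.

Lemma card_set_sum {T1 T2 : finType} (S : {set T1 + T2}) :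
  #|S| = #|[set x | inl x \in S]| + #|[set y | inr y \in S]|.
Proof.
rewrite -!sum1_card big_sumType /=.
by congr (_ + _); apply: eq_bigl => z; rewrite inE.
Qed.

(** Both sides count the incident pairs formed by a block in [P] and a point in [A]. The counting
    arguments below are instances of this for suitable [P] and [A]. *)
Lemma incidence_double_count {X I : finType} (B : I -> {set X}) (P : pred I)
    (A : {set X}) :
  \sum_(i | P i) #|B i :&: A| = \sum_(x in A) #|[set i | P i && (x \in B i)]|.
Proof.
under eq_bigr => i _ do
  (rewrite -sum1_card; under eq_bigl => x do rewrite inE andbC).
under [RHS]eq_bigr => x _ do
  (rewrite -sum1_card; under eq_bigl => i do rewrite inE).
rewrite (exchange_big_dep (fun x => x \in A)) /=; last by move=> i x _ /andP[].
by apply: eq_bigr => x xA; apply: eq_bigl => i; rewrite xA.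
Qed.

Lemma dominating_incidenceP {X I : finType} (B : I -> {set X})
    (S : {set X + I}) :
  reflect
    ((forall x, inl x \notin S -> exists2 i, inr i \in S & x \in B i) /\
     (forall i, inr i \notin S -> exists2 x, inl x \in S & x \in B i))
    (dominating (incidence_graph B) S).
Proof.
apply: (iffP forallP) => [dom | [domX domI] u].
  split=> [x xS | i iS].
    have /implyP/(_ xS)/existsP[[y|i] /andP[iS //= xi]] := dom (inl x).
    by exists i.
  have /implyP/(_ iS)/existsP[[x|j] /andP[xS //= xi]] := dom (inr i).
  by exists x.
apply/implyP; case: u => [x /domX[i iS xi] | i /domI[x xS xi]];
  apply/existsP.
- by exists (inr i); rewrite iS.
- by exists (inl x); rewrite xS.
Qed.

Lemma domination_numberP {V : finType} (e : rel V) (n : nat) :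
    (exists2 S : {set V}, dominating e S & #|S| <= n) ->
    (forall S : {set V}, dominating e S -> n <= #|S|) ->
  domination_number e = n.
Proof.
move=> [S domS leSn] min_n; rewrite /domination_number.
case: arg_minnP => [|M domM minM]; first exact: dominating_setT.
by apply/eqP; rewrite eqn_leq min_n // (leq_trans (minM S domS)).
Qed.

Lemma affine_plane_order_gt1 {X I : finType} (B : I -> {set X}) (q : nat) :
  is_affine_plane B q -> 1 < q.
Proof. by case=> /andP[]. Qed.

(** Each of the [q ^ 2 - 1] points other than [x] lies on exactly one line through [x], and each
    such line has [q - 1] of them; cancel [q - 1 > 0]. *)
Lemma affine_plane_card_lines_through {X I : finType} (B : I -> {set X})
    (q : nat) (hD : is_affine_plane B q) (x : X) :
  #|[set i | x \in B i]| = q.+1.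
Proof.
have q_gt1 := affine_plane_order_gt1 B q hD; case: hD => _ cX cB c1.
have := incidence_double_count B (fun i => x \in B i) (~: [set x]).
rewrite (eq_bigr (fun=> q.-1)) => [|i xi]; last first.
  by rewrite -setDE; have := cardsD1 x (B i); rewrite xi cB => ->.
rewrite [RHS](eq_bigr (fun=> 1)) => [|y]; last first.
  by rewrite !inE eq_sym => /c1.
rewrite sum1_card sum_nat_cond_const cardsC1 cX => eq_r.
nia.
Qed.

Lemma affine_plane_card_lines {X I : finType} (B : I -> {set X}) (q : nat)
    (hD : is_affine_plane B q) :
  #|I| = q ^ 2 + q.
Proof.
have q_gt1 := affine_plane_order_gt1 B q hD.
have := incidence_double_count B predT [set: X].
rewrite [RHS](eq_bigr (fun=> q.+1)) => [|x _]; last first.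
  exact: affine_plane_card_lines_through.
case: hD => _ cX cB _.
rewrite (eq_bigr (fun=> q)) => [|i _]; last by rewrite setIT.
rewrite !sum_nat_const cardsT cX -/#|I| => eq_b.
apply/eqP; rewrite -(eqn_pmul2r (ltnW q_gt1)) eq_b; apply/eqP; lia.
Qed.

(** Two common points would be joined by both [i] and [j], against uniqueness of the joining line.
    As [i] and [j] are indices and [1 < q], this also rules out repeated blocks. *)
Lemma affine_plane_lines_meet {X I : finType} (B : I -> {set X}) (q : nat)
    (hD : is_affine_plane B q) (i j : I) :
  i != j -> #|B i :&: B j| <= 1.
Proof.
case: hD => _ _ _ c1; apply: contraNT; rewrite -ltnNge => /card_gt1P[x [y []]].
rewrite !inE => /andP[xi xj] /andP[yi yj] /c1/eqP/cards1P[k eqk].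
have: i \in [set k] by rewrite -eqk inE xi.
have: j \in [set k] by rewrite -eqk inE xj.
by rewrite !inE => /eqP-> /eqP->.
Qed.

(** Playfair's axiom: joining [y] to the [q] points of [l] gives [q] distinct lines, so exactly one
    of the [q + 1] lines through [y] misses [l]. *)
Lemma affine_plane_parallel {X I : finType} (B : I -> {set X}) (q : nat)
    (hD : is_affine_plane B q) (l : I) (y : X) (yl : y \notin B l) :
  #|[set i | [disjoint B i & B l] && (y \in B i)]| = 1.
Proof.
have := incidence_double_count B (fun i => y \in B i) (B l).
(* A line through [y] is not [l], so it meets [l] in 0 or 1 points: the size of the intersection is
   the indicator of meeting. *)
rewrite (eq_bigr (fun i => ~~ [disjoint B i & B l] : nat)) => [|i yi]; last first.
  have il : i != l by apply: contraNneq yl => <-.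
  have := affine_plane_lines_meet B q hD i l il.
  by rewrite -setI_eq0 -cards_eq0; case: #|_| => [|[]].
have cy := affine_plane_card_lines_through B q hD y.
case: hD => _ _ cB c1.
rewrite [RHS](eq_bigr (fun=> 1)) => [|x xl]; last first.
  by apply: c1; apply: contraNneq yl => ->.
rewrite sum1_card cB -big_mkcondr /= sum1dep_card => c_meet.
have := cardsID [set i | [disjoint B i & B l]] [set i | y \in B i].
rewrite cy (_ : _ :&: _ = [set i | [disjoint B i & B l] && (y \in B i)]);
  last by apply/setP => i; rewrite !inE andbC.
rewrite (_ : _ :\: _ = [set i | (y \in B i) && ~~ [disjoint B i & B l]]);
  last by apply/setP => i; rewrite !inE andbC.
rewrite c_meet; lia.
Qed.

(** The lines disjoint from [l] partition the [q ^ 2 - q] points off [l] into sets of size [q]. *)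
Lemma affine_plane_card_parallel {X I : finType} (B : I -> {set X}) (q : nat)
    (hD : is_affine_plane B q) (l : I) :
  #|[set i | [disjoint B i & B l]]| = q.-1.
Proof.
have q_gt1 := affine_plane_order_gt1 B q hD.
have := incidence_double_count B (fun i => [disjoint B i & B l]) (~: B l).
rewrite [RHS](eq_bigr (fun=> 1)) => [|y]; last first.
  by rewrite inE => /(affine_plane_parallel B q hD l y).
case: hD => _ cX cB _.
rewrite (eq_bigr (fun=> q)) => [|i]; last first.
  by rewrite disjoints_subset => /setIidPl->.
have := cardsC (B l).
rewrite cB cX sum1_card sum_nat_cond_const => eq1 eq2.
nia.
Qed.

Lemma affine_plane_dominating_exists {X I : finType} (B : I -> {set X})
    (q : nat) (hD : is_affine_plane B q) :
  exists2 S : {set X + I},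
    dominating (incidence_graph B) S & #|S| <= 2 * q - 1.
Proof.
have q_gt1 := affine_plane_order_gt1 B q hD.
have /card_gt0P[l _] : 0 < #|I| by rewrite (affine_plane_card_lines B q hD); lia.
exists [set u | match u with
                | inl x => x \in B l
                | inr i => [disjoint B i & B l]
                end].
  apply/dominating_incidenceP; split=> [y | i]; rewrite inE.
    move/(affine_plane_parallel B q hD l y)/eqP/cards1P=> [i eqi].
    have: i \in [set i] by rewrite inE.
    by rewrite -eqi inE => /andP[il yi]; exists i; rewrite ?inE.
  rewrite -setI_eq0 => /set0Pn[x]; rewrite inE => /andP[xi xl].
  by exists x; rewrite ?inE.
rewrite card_set_sum.
rewrite (_ : [set x | _] = B l); last by apply/setP => x; rewrite !inE.
rewrite (_ : [set i | _] = [set i | [disjoint B i & B l]]); last first.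
  by apply/setP => i; rewrite !inE.
rewrite (affine_plane_card_parallel B q hD).
case: hD => _ _ -> _; lia.
Qed.

Lemma affine_plane_points_covered {X I : finType} (B : I -> {set X}) (q : nat)
    (hD : is_affine_plane B q) (P : {set X}) (L : {set I}) :
    (forall x, x \notin P -> exists2 i, i \in L & x \in B i) ->
  q ^ 2 - #|P| <= #|L| * q.
Proof.
case: hD => _ cX cB _ cov; rewrite -cX -(cardsC P) addKn.
have := incidence_double_count B (fun i => i \in L) (~: P) => eqs.
apply: (@leq_trans (\sum_(i in L) #|B i :&: ~: P|)).
  rewrite eqs -sum1_card; apply: leq_sum => x; rewrite inE => /cov[i iL xi].
  by apply/card_gt0P; exists i; rewrite inE iL.
rewrite -sum_nat_const; apply: leq_sum => i _.
by rewrite -(cB i) subset_leq_card ?subsetIl.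
Qed.

(** Among the lines outside [L], at most [q + 1] contain [p], and at most [(#|P| - 1) * q] avoid it.
    Singling out [p] saves [#|P| - 1] over the naive bound [#|P| * (q + 1)]. *)
Lemma affine_plane_lines_covered {X I : finType} (B : I -> {set X}) (q : nat)
    (hD : is_affine_plane B q) (P : {set X}) (L : {set I}) (p : X) :
    p \in P ->
    (forall i, i \notin L -> exists2 x, x \in P & x \in B i) ->
  q ^ 2 + q - #|L| <= 1 + #|P| * q.
Proof.
move=> pP cov.
have cI := affine_plane_card_lines B q hD.
have clt := affine_plane_card_lines_through B q hD.
have := incidence_double_count B (fun i => p \notin B i) (P :\ p).
(* Of the [q + 1] lines through [y], only the one joining it to [p] contains [p]. *)
rewrite [RHS](eq_bigr (fun=> q)) => [|y]; last first.
  rewrite !inE eq_sym => /andP[py _]; case: hD => _ _ _ /(_ p y py) c1.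
  have := cardsID [set i | p \in B i] [set i | y \in B i].
  rewrite clt (_ : _ :&: _ = [set i | (p \in B i) && (y \in B i)]); last first.
    by apply/setP => i; rewrite !inE andbC.
  rewrite c1 add1n => -[<-].
  by apply: eq_card => i; rewrite !inE.
rewrite sum_nat_const => eqs.
(* A line outside [L] that avoids [p] meets [P] in some other point, so it contributes at least 1 to
   the incidence sum. *)
have le : #|~: L :\: [set i | p \in B i]| <= #|P :\ p| * q.
  rewrite -eqs -sum1_card big_mkcond [leqRHS]big_mkcond /=.
  apply: leq_sum => i _; rewrite !inE.
  case: ifP => // /andP[pi iL]; rewrite pi.
  have [x xP xi] := cov i iL; apply/card_gt0P; exists x.
  by rewrite !inE xi xP andbT; apply: contraNneq pi => <-.
have cP := cardsD1 p P; rewrite pP in cP.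
have cL := cardsC L.
have := cardsID [set i | p \in B i] (~: L).
have : #|~: L :&: [set i | p \in B i]| <= q.+1.
  by rewrite -(clt p) subset_leq_card ?subsetIr.
nia.
Qed.

Lemma affine_plane_dominating_card {X I : finType} (B : I -> {set X}) (q : nat)
    (hD : is_affine_plane B q) (S : {set X + I}) :
  dominating (incidence_graph B) S -> 2 * q - 1 <= #|S|.
Proof.
have q_gt1 := affine_plane_order_gt1 B q hD.
move/dominating_incidenceP=> [domX domI]; rewrite card_set_sum.
set P := [set x | _]; set L := [set i | _].
(* With no point in [S] there is no [p] to single out, but then [S] contains all [q ^ 2 + q]
   lines. *)
have [P0 | [p pP]] := set_0Vmem P.
  have -> : L = [set: I].
    apply/setP => i; rewrite !inE; apply/negPn/negP => /domI[x xS _].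
    by have := in_set0 x; rewrite -P0 inE xS.
  rewrite cardsT (affine_plane_card_lines B q hD); nia.
have covX : forall x, x \notin P -> exists2 i, i \in L & x \in B i.
  by move=> x; rewrite inE => /domX[i iS xi]; exists i; rewrite ?inE.
have covI : forall i, i \notin L -> exists2 x, x \in P & x \in B i.
  by move=> i; rewrite inE => /domI[x xS xi]; exists x; rewrite ?inE.
have := affine_plane_points_covered B q hD P L covX.
have := affine_plane_lines_covered B q hD P L p pP covI.
move=> leI leX.
(* The sum of the two bounds is [2 * q ^ 2 + q - 1 <= (#|P| + #|L|) * (q + 1)], whose left side
   factors as [(2 * q - 1) * (q + 1)]. *)
have : (2 * q - 1) * q.+1 <= (#|P| + #|L|) * q.+1 by nia.
by rewrite leq_pmul2r.
Qed.

Theorem theorem4p3 (X I : finType) (B : I -> {set X}) (q : nat)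
    (hD : is_affine_plane B q) :
  design_gamma B = 2 * q - 1.
Proof.
apply: domination_numberP; first exact: affine_plane_dominating_exists.
exact: affine_plane_dominating_card.
Qed.
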